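(* If $X$ is a finite $\mathrm{CAT}(0)$ cube complex, then the number of vertices of $X$ is equal to the number of parallelism classes of cubes of $X$ of all dimensions (vertices, i.e. $0$-cubes, included).
   Context: Identify each $q$-cube with $[-\frac12,\frac12]^q$; its midplanes are its intersections with the $q$ coordinate hyperplanes of $\mathbb{R}^q$ (a vertex has no midplanes). Two midplanes in $X$ are equivalent if they are the first and last members of a finite sequence of midplanes in which the intersection of any two consecutive members is again a midplane. A hyperplane of $X$ is the union of all midplanes in an equivalence class; it cuts a cube if it contains a midplane of that cube. Two cubes $D_1,D_2$ of $X$ are parallel if they have the same dimension and every hyperplane that cuts $D_1$ also cuts $D_2$. This is an equivalence relation on cubes; its classes are the parallelism classes. (In particular any two vertices are parallel.) *)

(* Defs.v *)
From mathcomp Require Import all_boot.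

Set Implicit Arguments.
Unset Strict Implicit.
Unset Printing Implicit Defensive.

(** * Finite cube complexes *)

(* The vertices of the standard cube [-1/2,1/2]^q; [true] stands for the
   coordinate 1/2 and [false] for -1/2. *)
Definition std_vertex (q : nat) : finType := {ffun 'I_q -> bool}.

(* The face through the vertex [a] in which exactly the coordinates in [J]
   are free. *)
Definition std_face (q : nat) (J : {set 'I_q}) (a : std_vertex q)
  : {set std_vertex q} :=
  [set x : std_vertex q | [forall i, (i \notin J) ==> (x i == a i)]].

Definition std_faces (q : nat) : {set {set std_vertex q}} :=
  [set std_face Ja.1 Ja.2 | Ja : {set 'I_q} * std_vertex q].

(* Reflection of the standard cube in the i-th coordinate hyperplane. *)
Definition std_flip (q : nat) (i : 'I_q) (x : std_vertex q) : std_vertex q :=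
  [ffun j => (j == i) (+) x j].

(* A q-cube has 2 ^ q vertices. *)
Definition dim (V : finType) (C : {set V}) : nat := trunc_log 2 #|C|.

(* [f] identifies the standard q-cube with the cube [C], the faces of the
   standard cube corresponding exactly to the cubes of [K] contained in [C].
   Two such identifications differ by a symmetry of the standard cube. *)
Definition is_chart (V : finType) (K : {set {set V}}) (C : {set V}) (q : nat)
    (f : {ffun std_vertex q -> V}) : bool :=
  [&& injectiveb f,
      f @: [set: std_vertex q] == C
    & [set D in K | D \subset C] == [set f @: (F : {set std_vertex q}) | F in std_faces q]].

(* Finite cube complexes in the sense of Bridson and Haefliger (I.7.32): every
   cube is embedded, and two cubes that meet do so in one common face. A cube is
   then determined by its set of vertices, and is represented by it. *)
Record cube_complex : Type := CubeComplex {
  vertex :> finType;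
  cubes : {set {set vertex}};
  cubes1 : forall v : vertex, [set v] \in cubes;
  cubes_chart : forall C : {set vertex}, C \in cubes ->
    exists f : {ffun std_vertex (dim C) -> vertex}, is_chart cubes C f;
  cubesI : forall C D : {set vertex}, C \in cubes -> D \in cubes ->
    C :&: D != set0 -> C :&: D \in cubes
}.

(** * The CAT(0) condition: simply connected, with flag links *)

Section CAT0.
Variable X : cube_complex.

Definition edges : {set {set X}} := [set e in cubes X | dim e == 1].

Definition adjacent : rel X := [rel u v | (u != v) && ([set u; v] \in edges)].

(* The vertices of the link of [v] are the edges of X at [v]; every cube that
   contains [v] contributes the simplex spanned by its edges at [v] (the cube
   [set v] contributes the empty simplex). *)
Definition link (v : X) : {set {set {set X}}} :=
  [set [set e in edges | (v \in e) && (e \subset C)]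
     | C : {set X} in cubes X & v \in C].

Definition flag (T : finType) (L : {set {set T}}) : Prop :=
  forall S : {set T},
    (forall x y : T, x \in S -> y \in S -> [set x; y] \in L) -> S \in L.

(* Edge-path homotopy. An edge path is the sequence of its vertices; the two
   elementary moves delete a backtrack, and push the path across a square. *)
Inductive homotopic : seq X -> seq X -> Prop :=
| Homotopic_refl p : homotopic p p
| Homotopic_sym p1 p2 : homotopic p1 p2 -> homotopic p2 p1
| Homotopic_trans p1 p2 p3 :
    homotopic p1 p2 -> homotopic p2 p3 -> homotopic p1 p3
| Homotopic_backtrack p s u v :
    adjacent u v -> homotopic (p ++ [:: u; v; u] ++ s) (p ++ [:: u] ++ s)
| Homotopic_square p s a b c d :
    [set a; b; c; d] \in cubes X ->
    adjacent a b -> adjacent b c -> adjacent a d -> adjacent d c ->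
    homotopic (p ++ [:: a; b; c] ++ s) (p ++ [:: a; d; c] ++ s).

Definition simply_connected : Prop :=
  (forall u v : X, connect adjacent u v) /\
  (forall (u : X) (p : seq X),
     path adjacent u p -> last u p = u -> homotopic (u :: p) [:: u]).

Definition CAT0 : Prop :=
  simply_connected /\ (forall v : X, flag (link v)).

End CAT0.

(** * Midplanes, hyperplanes and parallelism *)

Section Hyperplanes.
Variable X : cube_complex.

(* A midplane of a q-cube is itself a (q-1)-cube, whose vertices are the
   midpoints of the edges that it crosses. Edges stand for their midpoints, and
   midplanes, hence also hyperplanes, for the sets of edge midpoints that they
   contain. The intersection of two midplanes is a midplane if and only if the
   intersection of the corresponding sets of edges corresponds to a midplane. *)
Definition chart_midplane (q : nat) (f : {ffun std_vertex q -> X}) (i : 'I_q)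
  : {set {set X}} :=
  [set [set f x; f (std_flip i x)] | x : std_vertex q].

Definition midplanes_of (C : {set X}) : {set {set {set X}}} :=
  [set M | [exists f : {ffun std_vertex (dim C) -> X},
             is_chart (cubes X) C f &&
             [exists i, M == chart_midplane f i]]].

Definition midplanes : {set {set {set X}}} :=
  \bigcup_(C in cubes X) midplanes_of C.

Definition midplane_step : rel {set {set X}} :=
  [rel M N | [&& M \in midplanes, N \in midplanes & M :&: N \in midplanes]].

Definition midplane_equiv : rel {set {set X}} := connect midplane_step.

Definition hyperplanes : {set {set {set X}}} :=
  [set \bigcup_(N in midplanes | midplane_equiv M N) N
     | M : {set {set X}} in midplanes].

Definition cuts (H : {set {set X}}) (C : {set X}) : bool :=
  [exists M in midplanes_of C, M \subset H].

Definition parallel : rel {set X} :=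
  [rel C D | (dim C == dim D) &&
             [forall H in hyperplanes, cuts H C ==> cuts H D]].

Definition parallelism_classes : {set {set {set X}}} :=
  equivalence_partition parallel (cubes X).

End Hyperplanes.

(* Main.v *)
(* Fix a base vertex o. The edges that descend from a vertex v towards o pairwise
   span squares, so by flagness they span a cube C(v), and v |-> [C(v)] is the
   bijection onto the parallelism classes.

   The metric facts behind this come from simple connectedness by van der
   Waerden's trick. Edge paths modulo pushing across squares satisfy an exchange
   property (here flagness fills in 3-cubes); hence the edges act on reduced path
   classes, the action respects homotopy, and every vertex has exactly one reduced
   class from o. It follows that the graph is bipartite and that two descending
   edges at a vertex span a square with descending opposite edges. Consequently
   opposite edges of a square have the same pair of halfspaces (the wall of the
   edge), edges with the same wall lie on the same hyperplane, and a cube is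
   determined up to parallelism by its set of walls.

   Injectivity: if v <> w, then, up to exchanging them, some edge at v descends both
   towards o and towards w; its wall does not separate o from w, whereas every wall
   of C(w) does. Surjectivity: a cube of a class that is closest to o equals C(v) up
   to parallelism, v being its top vertex. *)

Require Import Defs.
From mathcomp Require Import all_boot.
From Stdlib Require Import ClassicalEpsilon.
From mathcomp Require Import zify.

Set Implicit Arguments.
Unset Strict Implicit.
Unset Printing Implicit Defensive.

(** * Edge paths up to pushing across squares *)

Section SquareGraph.
Variables (T : finType) (adj : rel T) (sq : T -> T -> T -> T -> bool).
Hypothesis adj_sym : symmetric adj.
Hypothesis sq_adj : forall a b c d, sq a b c d -> adj a b.
Hypothesis sq_rot : forall a b c d, sq a b c d -> sq b c d a.
Hypothesis sq_sym : forall a b c d, sq a b c d -> sq a d c b.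
Hypothesis sq_neq : forall a b c d, sq a b c d -> a != c.
Hypothesis sq_uniq : forall a b c d d', sq a b c d -> sq a b c d' -> d = d'.
(** The trace of flag links: three squares around [y] bound a 3-cube, and [t] is its corner opposite
    [y]. *)
Hypothesis sq_cube : forall y a b c p q r,
  sq y a p b -> sq y b q c -> sq y a r c ->
  exists t, [/\ sq a p t r, sq b p t q & sq c q t r].

Lemma sq_rotV a b c d : sq a b c d -> sq d a b c.
Proof. by move=> /sq_rot /sq_rot /sq_rot. Qed.

(* Words list the vertices of an edge path from its end back to its start. *)
Inductive swap1 : seq T -> seq T -> Prop :=
| Swap_top z a b c r : sq z a c b -> swap1 (z :: a :: c :: r) (z :: b :: c :: r)
| Swap_cons x w w' : swap1 w w' -> swap1 (x :: w) (x :: w').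

Inductive swap : seq T -> seq T -> Prop :=
| Swap_refl w : swap w w
| Swap_step w1 w2 w3 : swap1 w1 w2 -> swap w2 w3 -> swap w1 w3.

Lemma swap_trans w1 w2 w3 : swap w1 w2 -> swap w2 w3 -> swap w1 w3.
Proof. by elim=> // u1 u2 u3 s12 _ IH /IH; apply: Swap_step. Qed.

Lemma swap1_sym w1 w2 : swap1 w1 w2 -> swap1 w2 w1.
Proof.
elim=> [z a b c r h|x w w' _ h]; last exact: Swap_cons.
by apply: Swap_top; apply: sq_sym.
Qed.

Lemma swap_sym w1 w2 : swap w1 w2 -> swap w2 w1.
Proof.
elim=> [w|u1 u2 u3 s12 _ IH]; first exact: Swap_refl.
by apply: swap_trans IH (Swap_step (swap1_sym s12) (Swap_refl _)).
Qed.

Lemma swap_cons x w1 w2 : swap w1 w2 -> swap (x :: w1) (x :: w2).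
Proof.
elim=> [w|u1 u2 u3 s12 _ IH]; first exact: Swap_refl.
exact: Swap_step (Swap_cons x s12) IH.
Qed.

Lemma swap_top z a b c r : sq z a c b -> swap (z :: a :: c :: r) (z :: b :: c :: r).
Proof. by move=> h; apply: Swap_step (Swap_top r h) (Swap_refl _). Qed.

Lemma swap_size w1 w2 : swap w1 w2 -> size w1 = size w2.
Proof.
elim=> // u1 u2 u3 s12 _ <-; elim: s12 => //= x w w' _ ->; done.
Qed.

Lemma swap_head x w1 w2 : swap w1 w2 -> head x w1 = head x w2.
Proof. by elim=> // u1 u2 u3 s12 _ <-; case: s12. Qed.

Lemma swap1_cons a p w : swap1 (a :: p) w -> exists p', w = a :: p'.
Proof.
move Eu: (a :: p) => u s.
by case: s Eu => [z' ? e c r ?|x ? ? ?] [-> _]; eexists.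
Qed.

Lemma swap_last x w1 w2 : swap w1 w2 -> last x w1 = last x w2.
Proof.
elim=> // u1 u2 u3 s12 _ <-; elim: s12 x => //= y w w' _ IH x; exact: IH.
Qed.

Definition walk (w : seq T) := if w is x :: w' then path adj x w' else true.

Lemma swap_walk w1 w2 : swap w1 w2 -> walk w1 -> walk w2.
Proof.
elim=> // u1 u2 u3 s12 _ IH h; apply: IH; elim: s12 h => /= [z a b c r s|x w w'].
  case/and3P=> _ _ ->; rewrite andbT; apply/andP; split.
    exact: sq_adj (sq_sym s).
  by rewrite adj_sym; apply: sq_adj (sq_rot (sq_rot s)).
case=> [z a b c r s|y {}w {}w' s] /=; last by move=> IH /andP[-> /IH].
by move=> IH /andP[-> /= /IH].
Qed.

(* In the one nontrivial case, three squares meet at a vertex and the opposite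
   squares of the 3-cube that they span close up the two paths. *)
Lemma swap_exchange z a b p q : swap (z :: a :: p) (z :: b :: q) ->
  (a = b /\ swap (a :: p) (b :: q)) \/
  exists c r, [/\ sq z a c b, swap (a :: p) (a :: c :: r)
                & swap (b :: q) (b :: c :: r)].
Proof.
(* The outer induction, on the length, serves to exchange tails; the inner one runs along the
   sequence of swaps. *)
have [n] := ubnP (size p); elim: n z a b p q => // n IHn z a b p q; rewrite ltnS => le_pn.
move Ew: (z :: a :: p) => w; move Ew': (z :: b :: q) => w' sww'.
elim: sww' z a p b q Ew Ew' le_pn => {w w'} [w|w1 w2 w3 s12 s23 IH] z a p b q Ew Ew' le_pn.
  by left; move: Ew'; rewrite -Ew => -[-> ->]; split => //; apply: Swap_refl.
subst w1 w3.
case Es: _ _ / s12 IH s23 => [z' a' e c r s|x w w' s] IH s23.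
  case: Es => ? ? ?; subst z' a' p.
  have le_rn : size (c :: r) <= n by [].
  case: (IH _ _ _ _ _ erefl erefl le_rn) => [[<- sq_]|[c' [r' [s' h1 h2]]]].
    by right; exists c, r; split; [ | exact: Swap_refl | exact: swap_sym].
  case: (IHn _ _ _ _ _ le_rn h1) => [[? h3]|[d [t [s'' h3 h4]]]].
    subst c'; left.
    have E : a = b by apply: sq_uniq (sq_rot (sq_rot s)) (sq_rot (sq_rot (sq_sym s'))).
    split=> //; rewrite E; apply: swap_trans (swap_cons b h3) _; exact: swap_sym.
  have [u [t1 t2 t3]] :=
    sq_cube (sq_rotV s) s'' (sq_rotV (sq_sym s')).
  right; exists u, (d :: t); split=> //.
    apply: swap_trans (swap_cons a h3) _; apply: swap_top.
    exact: sq_rotV (sq_sym t2).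
  apply: swap_trans h2 _; apply: swap_trans (swap_cons b h4) _; apply: swap_top.
  exact: sq_rotV t3.
case: Es => ? ?; subst x w.
have [p' Ep'] := swap1_cons s.
subst w'; have sp : swap (a :: p) (a :: p') := Swap_step s (Swap_refl _).
have le_p'n : size p' <= n by case: (swap_size sp) => <-.
case: (IH _ _ _ _ _ erefl erefl le_p'n) => [[? h]|[c [r [h1 h2 h3]]]].
  by left; split=> //; apply: swap_trans sp h.
by right; exists c, r; split=> //; apply: swap_trans sp h2.
Qed.

(** If swaps make [x] the second vertex of [w'], then [x :: w'] is equivalent to a path that ends
    with a backtrack. *)
Fixpoint reduced (w : seq T) : Prop :=
  if w is x :: w' then reduced w' /\ forall v t, ~ swap w' (v :: x :: t) else True.

(** A cancellation visible after a swap at the top was possible before it: either it is carried back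
    across the square, or exchange exposes it, by a square that uniqueness identifies with the given
    one. *)
Lemma reduced_swap w1 w2 : swap w1 w2 -> reduced w1 -> reduced w2.
Proof.
elim=> // {w1 w2} u1 u2 u3 s12 _ IH red1; apply: IH.
elim: s12 red1 => {u1 u2 u3} [z a b c r s|x w w' s IH] /=; last first.
  case=> /IH red' h; split=> // v t sw'; apply: (h v t).
  exact: Swap_step s sw'.
case=> -[[redr cr] acr] zacr; split; first (split; first by split).
  move=> v t scr; apply: (zacr a (b :: t)).
  have Ev : c = v by have := swap_head c scr.
  rewrite -Ev in scr *; apply: swap_trans (swap_cons a scr) _; apply: swap_top.
  exact: sq_rot s.
move=> v t sbcr.
have Ev : b = v by have := swap_head b sbcr.
rewrite -{v}Ev in sbcr.
case: (swap_exchange sbcr) => [[Ec _]|[d [r' [s' h1 h2]]]].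
  by have := sq_neq s; rewrite Ec eqxx.
have Ed : a = d by apply: sq_uniq (sq_rot (sq_rot s)) (sq_rotV (sq_sym s')).
by apply: (acr c r'); rewrite Ed.
Qed.

(* Appends the step to [z] to the path [w], cancelling it if some path equivalent
   to [w] ends with the reverse step. *)
Definition act (z : T) (w : seq T) : seq T :=
  match excluded_middle_informative (exists t, exists v, swap w (v :: z :: t)) with
  | left h => z :: sval (constructive_indefinite_description _ h)
  | right _ => z :: w
  end.

(** The other alternative of the exchange would be a square with [z] at two opposite corners. *)
Lemma swap_cons_inj v z t t' : swap (v :: z :: t) (v :: z :: t') -> swap (z :: t) (z :: t').
Proof.
case/swap_exchange=> [[]//|[c [r [/sq_rot/sq_neq]]]].
by rewrite eqxx.
Qed.

Lemma act_in z w v t : swap w (v :: z :: t) -> swap (act z w) (z :: t).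
Proof.
move=> h; rewrite /act; case: excluded_middle_informative => [ex|]; last first.
  by case; exists t, v.
case: constructive_indefinite_description => t' /= [v' h'].
have sw := swap_trans (swap_sym h') h.
have /= E := swap_head v sw; subst v'; exact: swap_cons_inj sw.
Qed.

Lemma act_out z w : (forall v t, ~ swap w (v :: z :: t)) -> act z w = z :: w.
Proof.
move=> h; rewrite /act; case: excluded_middle_informative => // -[t [v h']].
by case: (h v t).
Qed.

Lemma act_case z w :
  (exists v t, swap w (v :: z :: t)) \/ (forall v t, ~ swap w (v :: z :: t)).
Proof.
case: (classic (exists v t, swap w (v :: z :: t))) => [|h]; [by left|right].
by move=> v t h'; apply: h; exists v, t.
Qed.

Lemma act_cons z w : exists t, act z w = z :: t.
Proof. by rewrite /act; case: excluded_middle_informative => h; eexists. Qed.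

Lemma act_swap z w w' : swap w w' -> swap (act z w) (act z w').
Proof.
move=> s; case: (act_case z w) => [[v [t h]]|h].
  apply: swap_trans (act_in h) _; apply: swap_sym; apply: (@act_in _ _ v).
  exact: swap_trans (swap_sym s) h.
rewrite (act_out h) act_out; first exact: swap_cons.
by move=> v t h'; apply: (h v t); apply: swap_trans s h'.
Qed.

Lemma reduced_act z w : reduced w -> reduced (act z w).
Proof.
move=> r; case: (act_case z w) => [[v [t h]]|h]; last by rewrite act_out.
apply: reduced_swap (swap_sym (act_in h)) _.
by case: (reduced_swap h r).
Qed.

Lemma walk_act v z t : adj v z -> walk (v :: t) -> walk (act z (v :: t)).
Proof.
move=> vz wk; case: (act_case z (v :: t)) => [[x [s h]]|h].
  by apply: swap_walk (swap_sym (act_in h)) _; have /= /andP[] := swap_walk h wk.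
by rewrite act_out //= adj_sym vz.
Qed.

Lemma last_act x z w : w != [::] -> last x (act z w) = last x w.
Proof.
move=> w0; case: (act_case z w) => [[v [t h]]|h].
  by rewrite (swap_last x (act_in h)) (swap_last x h).
by rewrite act_out //; case: w w0 {h}.
Qed.

(** If the step to [z] cancels, reducedness keeps the step back from cancelling too; otherwise the
    step back cancels the one just made. *)
Lemma act_back v z t : reduced (v :: t) -> swap (act v (act z (v :: t))) (v :: t).
Proof.
move=> r; case: (act_case z (v :: t)) => [[x [s h]]|h]; last first.
  by rewrite (act_out h); apply: (@act_in _ _ z); apply: Swap_refl.
have /= E := swap_head v h; subst x.
apply: swap_trans (act_swap v (act_in h)) _; rewrite act_out; first exact: swap_sym.
by case: (reduced_swap h r).
Qed.

Lemma act_square a b c d t : reduced (a :: t) -> sq a b c d ->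
  swap (act c (act b (a :: t))) (act c (act d (a :: t))).
Proof.
(* Only the step to [x] cancels: both routes end in the class of [c :: x :: p]. *)
have half x y : sq a x c y -> reduced (a :: t) ->
    (exists v s, swap (a :: t) (v :: x :: s)) -> (forall v s, ~ swap (a :: t) (v :: y :: s)) ->
    swap (act c (act x (a :: t))) (act c (act y (a :: t))).
  move=> s r [v [p h]] hy; rewrite (act_out hy).
  have /= E := swap_head a h; subst v.
  apply: swap_trans (act_swap c (act_in h)) _.
  rewrite act_out => [|v q h'].
    apply: swap_sym; apply: (@act_in _ _ y).
    apply: swap_trans (swap_cons y h) _; apply: swap_top.
    exact: sq_rotV s.
  have /= E := swap_head x h'; subst v.
  apply: (hy a (c :: q)); apply: swap_trans h _.
  by apply: swap_trans (swap_cons a h') _; apply: swap_top; apply: s.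
(* Otherwise exchange in [y :: a :: t] gives a square on [y], [a], [c]; its fourth corner is [x], so
   the step to [x] would cancel. *)
have outc x y : sq a x c y -> (forall v s, ~ swap (a :: t) (v :: x :: s)) ->
    forall v s, ~ swap (y :: a :: t) (v :: c :: s).
  move=> s hx v q h; have /= E := swap_head y h; subst v.
  case: (swap_exchange h) => [[E _]|[e [r [s' h1 _]]]].
    by have := sq_neq s; rewrite E eqxx.
  have E : x = e by apply: sq_uniq (sq_rot (sq_rot s)) (sq_rotV s').
  by apply: (hx a r); rewrite E.
move=> r s; have s' := sq_sym s.
case: (act_case b (a :: t)) => [Hb|Hb]; case: (act_case d (a :: t)) => [Hd|Hd]; last 1 first.
- rewrite (act_out Hb) (act_out Hd) !act_out; [|exact: outc s Hb|exact: outc s' Hd].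
  by apply: swap_top; apply: sq_rot (sq_rot s').
- case: Hb Hd => [v [p hb]] [v' [q hd]].
  have /= E := swap_head a hb; subst v; have /= E := swap_head a hd; subst v'.
  (* Both steps cancel: the exchange square is the given one, so the step to [c] cancels once more
     on either route. *)
  case: (swap_exchange (swap_trans (swap_sym hb) hd)) => [[E _]|[e [r' [s2 h1 h2]]]].
    by have := sq_neq (sq_rot s); rewrite E eqxx.
  have E : e = c by apply: sq_uniq (sq_rotV s2) (sq_rotV s).
  subst e; apply: swap_trans (act_swap c (act_in hb)) _.
  apply: swap_trans (act_in h1) _; apply: swap_sym.
  by apply: swap_trans (act_swap c (act_in hd)) (act_in h2).
- exact: half.
by apply: swap_sym; apply: half.
Qed.

(** * Evaluation of edge paths to reduced words *)

Definition eval (u : T) (p : seq T) : seq T := foldl (fun w z => act z w) [:: u] p.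

Definition evals (s : seq T) : seq T := if s is u :: p then eval u p else [::].

Lemma foldl_act_swap w w' p : swap w w' ->
  swap (foldl (fun w z => act z w) w p) (foldl (fun w z => act z w) w' p).
Proof. by elim: p w w' => //= z p IH w w' s; apply: IH; apply: act_swap. Qed.

Lemma eval_rcons u p z : eval u (rcons p z) = act z (eval u p).
Proof. by rewrite /eval -cats1 foldl_cat. Qed.

Lemma swap_nil x w : ~ swap [::] (x :: w).
Proof. by move/swap_size. Qed.

Lemma reduced_eval u p : reduced (eval u p).
Proof.
elim/last_ind: p => [|p z IH]; last by rewrite eval_rcons; apply: reduced_act.
by split=> // v t /swap_nil.
Qed.

Lemma eval_cons u p : exists t, eval u p = last u p :: t.
Proof.
elim/last_ind: p => [|p z IH]; first by exists [::].
by rewrite eval_rcons last_rcons; apply: act_cons.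
Qed.

Lemma walk_eval u p : path adj u p -> walk (eval u p).
Proof.
elim/last_ind: p => // p z IH; rewrite rcons_path eval_rcons => /andP[/IH].
by case: (eval_cons u p) => t ->; move=> wk az; apply: walk_act.
Qed.

Lemma last_eval x u p : last x (eval u p) = u.
Proof.
elim/last_ind: p => // p z IH; rewrite eval_rcons last_act //.
by case: (eval_cons u p) => t ->.
Qed.

Lemma evals_cat p a s :
  evals (p ++ a :: s) = foldl (fun w z => act z w) (evals (rcons p a)) s.
Proof. by case: p => //= x p; rewrite /eval -cat_rcons foldl_cat. Qed.

Lemma evals_rcons p a : exists2 t, evals (rcons p a) = a :: t & reduced (a :: t).
Proof.
case: p => [|x p] /=; first by exists [::] => //=; split=> // v t /swap_nil.
have := reduced_eval x (rcons p a); case: (eval_cons x (rcons p a)) => t.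
by rewrite last_rcons => ->; exists t.
Qed.

Lemma evals_backtrack p s u v :
  swap (evals (p ++ [:: u; v; u] ++ s)) (evals (p ++ [:: u] ++ s)).
Proof.
rewrite !evals_cat /=; apply: foldl_act_swap.
by case: (evals_rcons p u) => t -> r; apply: act_back.
Qed.

Lemma evals_square p s a b c d : sq a b c d ->
  swap (evals (p ++ [:: a; b; c] ++ s)) (evals (p ++ [:: a; d; c] ++ s)).
Proof.
move=> h; rewrite !evals_cat /=; apply: foldl_act_swap.
by case: (evals_rcons p a) => t -> r; apply: act_square.
Qed.

Lemma reduced_foldl w p : reduced w -> reduced (foldl (fun w z => act z w) w p).
Proof. by elim: p w => //= z p IH w r; apply: IH; apply: reduced_act. Qed.

(** [rev (belast u q)] retraces [q] from its end; the turn at [u] cancels first, then the turns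
    further along [q]. *)
Lemma foldl_act_back u q t : reduced (last u q :: t) ->
  swap (foldl (fun w z => act z w)
          (foldl (fun w z => act z w) (last u q :: t) (rev (belast u q))) q)
    (last u q :: t).
Proof.
elim: q u => [|x q IH] u r /=; first exact: Swap_refl.
rewrite rev_cons -cats1 foldl_cat /=.
have [t' Et' r'] : exists2 t',
    foldl (fun w z => act z w) (last x q :: t) (rev (belast x q)) = x :: t' & reduced (x :: t').
  case: q {IH} r => [|y q] /= r; first by exists t.
  rewrite rev_cons -cats1 foldl_cat /=.
  set w := foldl _ _ _; have [t' E] := act_cons x w; exists t'; first exact: E.
  by rewrite -[_ /\ _]/(reduced (x :: t')) -E; apply: reduced_act; apply: reduced_foldl.
rewrite Et'; apply: swap_trans (foldl_act_swap _ (act_back _ r')) _.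
by rewrite -Et'; apply: IH.
Qed.

(** * Normal forms and the graph distance *)

Hypothesis conn : forall u v, connect adj u v.
Hypothesis loop : forall u p, path adj u p -> last u p = u -> swap (eval u p) [:: u].

(** Following [p] and then [q] backwards is a loop, which evaluates to the trivial word; letting [q]
    act on both sides undoes the way back. *)
Lemma eval_unique u p q : path adj u p -> path adj u q -> last u p = last u q ->
  swap (eval u p) (eval u q).
Proof.
move=> pp pq Epq; have [t Et] := eval_cons u p.
have rt : reduced (last u q :: t) by rewrite -Epq -Et; apply: reduced_eval.
have h := foldl_act_back rt; rewrite -Epq -Et in h.
apply: swap_trans (swap_sym h) _; rewrite /eval; apply: foldl_act_swap.
have -> : foldl (fun w z => act z w) (eval u p) (rev (belast u q)) =
          eval u (p ++ rev (belast u q)) by rewrite /eval foldl_cat.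
apply: loop; first rewrite cat_path pp Epq rev_path.
  by under eq_path => x y do rewrite adj_sym.
by case: (q) Epq => [|x q'] ; rewrite ?last_cat //= => _; rewrite rev_cons last_rcons.
Qed.

Lemma path_exists u v : exists p, path adj u p /\ last u p = v.
Proof. by case/connectP: (conn u v) => p pp ->; exists p. Qed.

(** The choice of the path is immaterial up to [swap], by [eval_unique]. *)
Definition nf u v := eval u (sval (constructive_indefinite_description _ (path_exists u v))).

Lemma nf_eval u p : path adj u p -> swap (nf u (last u p)) (eval u p).
Proof.
move=> pp; rewrite /nf; case: constructive_indefinite_description => q /= [pq E].
exact: eval_unique.
Qed.

Lemma nf_spec u v : exists2 p, path adj u p /\ last u p = v & nf u v = eval u p.
Proof. by rewrite /nf; case: constructive_indefinite_description => q /= h; exists q. Qed.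

Lemma nf_cons u v : exists t, nf u v = v :: t.
Proof. by case: (nf_spec u v) => p [_ <-] ->; apply: eval_cons. Qed.

Lemma nf_act u v z : adj v z -> swap (nf u z) (act z (nf u v)).
Proof.
case: (nf_spec u v) => p [pp <-] -> vz; rewrite -eval_rcons.
by have := @nf_eval u (rcons p z); rewrite last_rcons; apply; rewrite rcons_path pp.
Qed.

(** The number of steps of the normal form; it is the graph distance, by [dist_path] and
    [dist_geod]. *)
Definition dist u v := (size (nf u v)).-1.

Lemma size_nf u v : size (nf u v) = (dist u v).+1.
Proof. by rewrite /dist; case: (nf_cons u v) => t ->. Qed.

Lemma dist_down u v z t : adj v z -> swap (nf u v) (v :: z :: t) -> dist u v = (dist u z).+1.
Proof.
move=> vz h; have := swap_size (swap_trans (nf_act u vz) (act_in h)).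
by have := swap_size h; rewrite !size_nf /=; lia.
Qed.

Lemma distxx u : dist u u = 0.
Proof. by have := swap_size (@nf_eval u [::] isT); rewrite size_nf /= => -[]. Qed.

(** A step either cancels or lengthens the normal form; hence the graph is bipartite. *)
Lemma dist_adj u v z : adj v z -> dist u z = (dist u v).+1 \/ dist u v = (dist u z).+1.
Proof.
move=> vz; case: (act_case z (nf u v)) => [[x [t h]]|h].
  right; apply: (@dist_down _ _ _ t) => //; rewrite [X in X :: _](_ : v = x) //.
  by case: (nf_cons u v) => s Es; have := swap_head v h; rewrite Es /= => ->.
by left; have := swap_size (nf_act u vz); rewrite act_out //= !size_nf => -[].
Qed.

(** The second vertex of the normal form is one step closer to [u]. *)
Lemma dist_desc u v : u != v -> exists2 a, adj v a & dist u v = (dist u a).+1.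
Proof.
case: (nf_spec u v) => p [pp _] E; case: (nf_cons u v) => t Et.
have := walk_eval pp; have := last_eval u u p; rewrite -E Et /=.
case: t Et => [|a t] Et /= => [->|_ /andP[va _] _]; first by rewrite eqxx.
by exists a => //; apply: (@dist_down _ _ _ t) => //; rewrite Et; apply: Swap_refl.
Qed.

(** The quadrangle condition: the normal forms of [a] and [b], prolonged to [v], are equivalent
    words, and their exchange square is the one sought. *)
Lemma dist_quad u v a b : adj v a -> adj v b -> a != b ->
  dist u v = (dist u a).+1 -> dist u v = (dist u b).+1 ->
  exists2 c, sq v a c b & dist u a = (dist u c).+1.
Proof.
move=> va vb ab da db.
have up x : adj v x -> dist u v = (dist u x).+1 -> swap (nf u v) (v :: nf u x).
  move=> vx dx; have := nf_act u (etrans (adj_sym x v) vx).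
  case: (act_case v (nf u x)) => [[y [t h]]|h]; last by rewrite act_out.
  move=> h'; have := swap_size (swap_trans h' (act_in h)); have := swap_size h.
  by rewrite !size_nf /=; lia.
have h := swap_trans (swap_sym (up a va da)) (up b vb db).
case: (nf_cons u a) (nf_cons u b) h => [p Ea] [q Eb]; rewrite Ea Eb => /swap_exchange.
case=> [[E _]|[c [r [s h _]]]]; first by rewrite E eqxx in ab.
exists c => //; apply: (@dist_down _ _ _ r); first exact: sq_adj (sq_rot s).
by rewrite Ea.
Qed.

Lemma dist_path u v p : path adj v p -> dist u (last v p) <= dist u v + size p.
Proof.
elim: p v => [|x p IH] v /=; first by rewrite addn0.
by case/andP=> vx /IH; case: (dist_adj u vx); lia.
Qed.

Lemma dist_eq0 u v : dist u v = 0 -> u = v.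
Proof. by move=> h; apply/eqP; apply: contraTT isT => /dist_desc[a _]; rewrite h. Qed.

Lemma dist_geod u v : exists p, [/\ path adj v p, last v p = u & size p = dist u v].
Proof.
move En: (dist u v) => n; elim: n v En => [|n IH] v En.
  by exists [::]; rewrite (dist_eq0 En).
have uv : u != v by apply: contraPneq En => ->; rewrite distxx.
case: (dist_desc uv) => a va; rewrite En => -[Ea]; case: (IH a (esym Ea)) => p [pp lp sp].
by exists (a :: p); rewrite /= va pp lp sp.
Qed.

Lemma dist_sym u v : dist u v = dist v u.
Proof.
have le x y : dist y x <= dist x y.
  by case: (dist_geod x y) => p [/(dist_path y) h lp <-]; rewrite distxx lp in h.
by apply/eqP; rewrite eqn_leq !le.
Qed.

(** These five properties are all that the later arguments use of the distance. *)
Lemma exists_metric : exists d : T -> T -> nat,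
  [/\ forall u, d u u = 0, forall u v, d u v = d v u,
      forall u v z, adj v z -> d u z = (d u v).+1 \/ d u v = (d u z).+1,
      forall u v, u != v -> exists2 a, adj v a & d u v = (d u a).+1 &
      forall u v a b, adj v a -> adj v b -> a != b ->
        d u v = (d u a).+1 -> d u v = (d u b).+1 ->
        exists2 c, sq v a c b & d u a = (d u c).+1].
Proof.
exists dist; split; [exact: distxx|exact: dist_sym|exact: dist_adj|exact: dist_desc|].
exact: dist_quad.
Qed.

End SquareGraph.

(** * Halfspaces of the graph metric *)

Section Halfspaces.
Variables (T : finType) (adj : rel T) (sq : T -> T -> T -> T -> bool).
Hypothesis adj_sym : symmetric adj.
Hypothesis sq_adj : forall a b c d, sq a b c d -> adj a b.
Hypothesis sq_rot : forall a b c d, sq a b c d -> sq b c d a.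
Hypothesis sq_sym : forall a b c d, sq a b c d -> sq a d c b.
Hypothesis sq_neq : forall a b c d, sq a b c d -> a != c.
Hypothesis sq_uniq : forall a b c d d', sq a b c d -> sq a b c d' -> d = d'.
Variable d : T -> T -> nat.
Hypothesis dxx : forall u, d u u = 0.
Hypothesis d_sym : forall u v, d u v = d v u.
Hypothesis d_adj : forall u v z, adj v z -> d u z = (d u v).+1 \/ d u v = (d u z).+1.
Hypothesis d_desc : forall u v, u != v -> exists2 a, adj v a & d u v = (d u a).+1.
Hypothesis d_quad : forall u v a b, adj v a -> adj v b -> a != b ->
  d u v = (d u a).+1 -> d u v = (d u b).+1 ->
  exists2 c, sq v a c b & d u a = (d u c).+1.

Definition halfspace (u v : T) : {set T} := [set x | d x u < d x v].

Definition wall (u v : T) : {set {set T}} := [set halfspace u v; halfspace v u].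

Lemma d_eq0 u v : d u v = 0 -> u = v.
Proof. by move=> h; apply/eqP; apply: contraTT isT => /d_desc[a _]; rewrite h. Qed.

Lemma d_adj1 u v : adj u v -> d u v = 1.
Proof. by move=> uv; case: (d_adj u uv); rewrite dxx. Qed.

(** Otherwise both [u] and [v'] descend from [v] towards [x]; the quadrangle square is then the
    given one and puts [u'] nearer to [x] than [v']. *)
Lemma halfspace_sub u v v' u' : sq u v v' u' -> halfspace u v \subset halfspace u' v'.
Proof.
move=> s; apply/subsetP => x; rewrite !inE => xuv.
have vu : adj v u by rewrite adj_sym; apply: sq_adj s.
have uu' : adj u u' by apply: sq_adj (sq_sym s).
have vv' : adj v v' by apply: sq_adj (sq_rot s).
have v'u' : adj v' u' by apply: sq_adj (sq_rot (sq_rot s)).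
have s' : sq v u u' v' by apply: sq_sym (sq_rot s).
have neq : u != v' by apply: sq_neq s.
have := d_adj x vu; have := d_adj x uu'; have := d_adj x vv'; have := d_adj x v'u'.
move=> h1 h2 h3 h4; rewrite ltnNge; apply/negP => h5.
have e1 : d x v = (d x u).+1 by lia.
have e2 : d x v = (d x v').+1 by lia.
have [c sc ec] := d_quad vu vv' neq e1 e2.
have E : c = u' by apply: sq_uniq (sq_rot (sq_rot (sq_rot sc))) (sq_rot (sq_rot (sq_rot s'))).
subst c; lia.
Qed.

Lemma halfspace_sq u v v' u' : sq u v v' u' -> halfspace u v = halfspace u' v'.
Proof.
move=> s; apply/eqP; rewrite eqEsubset halfspace_sub //.
by apply: halfspace_sub; apply: sq_rot (sq_sym s).
Qed.

Lemma wall_sq u v v' u' : sq u v v' u' -> wall u v = wall u' v'.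
Proof.
move=> s; rewrite /wall (halfspace_sq s).
by congr [set _; _]; apply: halfspace_sq (sq_sym (sq_rot s)).
Qed.

(* [Q] propagates along a ladder of squares joining the two edges, found by
   descending the distance from [u]. *)
Lemma halfspace_ladder (Q : T -> T -> Prop) u v u' v' :
    (forall a b b' a', sq a b b' a' -> Q a b -> Q a' b') ->
    adj u v -> adj u' v' -> halfspace u v = halfspace u' v' -> Q u v -> Q u' v'.
Proof.
move=> Qsq uv + + Quv; move Ek: (d u u') => k.
elim: k u' v' Ek => [|k IH] u' v' Ek u'v' E.
all: have [duv du'v'] := (d_adj1 uv, d_adj1 u'v').
(* Comparing the halfspaces at the four endpoints gives [d u u' = d v v'], with both crossing
   distances one larger. *)
all: have /setP E' := E; have := E' u; have := E' v; have := E' u'; have := E' v'.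
all: rewrite !inE !dxx !(d_sym v u) !(d_sym v' u') !(d_sym u' u).
all: rewrite !(d_sym v' u) !(d_sym u' v) !(d_sym v' v).
all: rewrite duv du'v' /= => h1 h2 h3 h4.
all: have := d_adj u u'v'; have := d_adj v u'v'; have := d_adj u' uv; have := d_adj v' uv.
all: rewrite !(d_sym u' u) !(d_sym v' u) !(d_sym u' v) !(d_sym v' v).
all: move=> a1 a2 a3 a4.
  have <- : u = u' by apply: d_eq0.
  by have <- : v = v' by apply: d_eq0; lia.
have nuu' : u != u' by apply: contraPneq Ek => <-; rewrite dxx.
have [w u'w ew] := d_desc nuu'.
have := d_adj w uv; have := d_adj v u'w; rewrite !(d_sym w) => a5 a6.
have wv' : w != v' by apply: contraPneq ew => ->; lia.
(* Both [w] and [v'] descend from [u'] towards [v]; their square carries the edge at [u'] to an edge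
   at [w], closer to [u]. *)
have [c s ec] : exists2 c, sq u' w c v' & d v w = (d v c).+1.
  by apply: d_quad => //; lia.
have s' := sq_rot s.
apply: (Qsq _ _ _ _ s'); apply: IH; [lia|exact: sq_adj s'|].
by rewrite E (halfspace_sq s').
Qed.

Lemma wall_ladder (Q : T -> T -> Prop) u v u' v' :
    (forall a b, Q a b -> Q b a) ->
    (forall a b b' a', sq a b b' a' -> Q a b -> Q a' b') ->
    adj u v -> adj u' v' -> wall u v = wall u' v' -> Q u v -> Q u' v'.
Proof.
move=> Qsym Qsq uv u'v' E Quv.
have : halfspace u' v' \in wall u v by rewrite E set21.
rewrite !inE => /orP[]/eqP E'; first exact: (halfspace_ladder Qsq uv).
by apply: (halfspace_ladder Qsq _ _ (esym E') (Qsym _ _ Quv)); rewrite // adj_sym.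
Qed.

(** For [a != b], parity puts [b] at distance greater than 1 from [a], so [b] is on the side of [v]
    for the first edge but not for the second; [v] itself rules out the opposite orientation. *)
Lemma wall_inj v a b : adj v a -> adj v b -> wall v a = wall v b -> a = b.
Proof.
move=> va vb E; apply/eqP; apply: contraT => ab.
have : halfspace v a \in wall v b by rewrite -E set21.
have da : d v a = 1 := d_adj1 va; have db : d v b = 1 := d_adj1 vb.
have ba : 1 < d b a.
  have := d_adj b va; rewrite (d_sym b v) db => h.
  have : d b a != 0 by apply: contra_neq ab => /d_eq0.
  lia.
rewrite !inE => /orP[]/eqP /setP E'; first by have := E' b; rewrite !inE dxx (d_sym b v) db; lia.
by have := E' v; rewrite !inE dxx da db.
Qed.

(* [w] is on the side of [o] of the first wall, and [wall w b] separates them. *)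
Lemma wall_down_neq o v w a b : adj v a -> adj w b ->
  d o v = (d o a).+1 -> d o w = (d o b).+1 -> d w v = (d w a).+1 ->
  wall v a <> wall w b.
Proof.
move=> va wb ev ew evw E.
have : halfspace b w \in wall v a by rewrite E set22.
rewrite !inE => /orP[]/eqP /setP E'.
  by have := E' o; rewrite !inE; lia.
by have := E' w; rewrite !inE dxx; lia.
Qed.

(** Induction along a geodesic from [v] to [w]: if its first step [a] ascends from [o], the
    inequality persists at [a], and the quadrangle condition brings the common descent found there
    back to [v]. *)
Lemma common_descent o v w : d o w < d o v + d v w ->
  exists a, [/\ adj v a, d o v = (d o a).+1 & d w v = (d w a).+1].
Proof.
move Ek: (d v w) => k; elim: k v Ek => [|k IH] v Ek lt.
  by rewrite (d_eq0 Ek) addn0 ltnn in lt.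
have wv : w != v by apply: contraPneq Ek => ->; rewrite dxx.
have [a va ea] := d_desc wv; rewrite d_sym in Ek.
case: (d_adj o va) => da; last by exists a.
have dak : d a w = k by rewrite d_sym; lia.
have [|b [ab eb ewb]] := IH a dak; first by lia.
have vb : v != b by apply: contraPneq ewb => <-; lia.
have [c s ec] : exists2 c, sq a v c b & d o v = (d o c).+1.
  by apply: (@d_quad _ a) => //; rewrite adj_sym.
exists c; split=> //; first exact: sq_adj (sq_rot s).
have cb : adj c b by apply: sq_adj (sq_rot (sq_rot s)).
have := d_adj w cb; have := d_adj w (sq_adj (sq_rot s)); lia.
Qed.

End Halfspaces.

(** * Cubes and charts *)

Section StandardCube.
Variable q : nat.
Implicit Types (x y : std_vertex q) (i j k : 'I_q) (J : {set 'I_q}).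

Lemma std_flipK i : involutive (@std_flip q i).
Proof. by move=> x; apply/ffunP => j; rewrite !ffunE addKb. Qed.

Lemma std_flipC i j x : std_flip i (std_flip j x) = std_flip j (std_flip i x).
Proof. by apply/ffunP => k; rewrite !ffunE addbCA. Qed.

Lemma std_flip_neq i x : x != std_flip i x.
Proof. by apply/eqP => /ffunP /(_ i); rewrite !ffunE eqxx; case: (x i). Qed.

Lemma std_flip_inj i j x : std_flip i x = std_flip j x -> i = j.
Proof.
by move/ffunP/(_ i); rewrite !ffunE eqxx => /addIb /esym /eqP.
Qed.

Lemma std_flip2_neq i j k x : i != j -> std_flip j (std_flip i x) != std_flip k x.
Proof.
move=> ij; apply/eqP => /ffunP E; have := E i; have := E j; rewrite !ffunE !eqxx.
rewrite (eq_sym j) (negbTE ij) /=.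
case: eqP => [<-|_]; case: eqP => [ik|_]; try by case: (x i); case: (x j).
by rewrite ik eqxx in ij.
Qed.

Lemma in_std_face J x y : (y \in std_face J x) = [forall i, (i \notin J) ==> (y i == x i)].
Proof. by rewrite inE. Qed.

Lemma std_face_refl J x : x \in std_face J x.
Proof. by rewrite in_std_face; apply/forallP => i; rewrite eqxx implybT. Qed.

Lemma std_face_eq J a x : x \in std_face J a -> std_face J a = std_face J x.
Proof.
rewrite in_std_face => /forallP h; apply/setP => y; rewrite !in_std_face.
by apply/forallP/forallP => h' i; move: (h i) (h' i); case: (i \in J) => //= /eqP ->.
Qed.

Lemma std_flip_face J x y i : y \in std_face J x -> (std_flip i y \in std_face J x) = (i \in J).
Proof.
move/std_face_eq ->; rewrite in_std_face; apply/forallP/idP => [/(_ i)|iJ j].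
  by rewrite ffunE eqxx; case: (i \in J) => //=; case: (y i).
by rewrite ffunE; case: (eqVneq j i) => [->|_] /=; rewrite ?iJ ?eqxx ?implybT.
Qed.

Lemma std_face1 i x : std_face [set i] x = [set x; std_flip i x].
Proof.
apply/setP => y; rewrite in_std_face !inE; apply/idP/idP => [/forallP h|].
  have E j : j != i -> y j = x j by move=> ji; have := h j; rewrite inE ji => /eqP.
  case: (eqVneq (y i) (x i)) => yi.
    by apply/orP; left; apply/eqP/ffunP => j; case: (eqVneq j i) => [->|/E].
  apply/orP; right; apply/eqP/ffunP => j; rewrite ffunE.
  case: (eqVneq j i) => [->|/E] //=; by move: yi; case: (y i); case: (x i).
case/orP=> /eqP ->; first by rewrite -in_std_face std_face_refl.
by rewrite -in_std_face std_flip_face ?std_face_refl ?inE.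
Qed.

Lemma std_face2 i j x : i != j -> std_face [set i; j] x =
  [set x; std_flip i x; std_flip j (std_flip i x); std_flip j x].
Proof.
move=> ij; apply/setP => y; apply/idP/idP => [|]; last first.
  rewrite !inE -!orbA => /or4P[] /eqP ->; rewrite -in_std_face ?std_face_refl //.
  - by rewrite std_flip_face ?std_face_refl ?inE ?eqxx.
  - by rewrite !std_flip_face ?std_face_refl ?inE ?eqxx ?orbT.
  - by rewrite std_flip_face ?std_face_refl ?inE ?eqxx ?orbT.
case: (eqVneq (y j) (x j)) => yj.
  move=> h; suff : y \in std_face [set i] x by rewrite std_face1 !inE => /orP[] ->; rewrite ?orbT.
  rewrite in_std_face; apply/forallP => k; apply/implyP; rewrite inE => ki.
  case: (eqVneq k j) => [->|kj]; first by rewrite yj.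
  by move: h; rewrite in_std_face => /forallP /(_ k); rewrite !inE (negbTE ki) (negbTE kj).
move=> h; suff : y \in std_face [set i] (std_flip j x).
  by rewrite std_face1 !inE std_flipC => /orP[] ->; rewrite ?orbT.
rewrite in_std_face; apply/forallP => k; apply/implyP; rewrite inE => ki; rewrite ffunE.
case: (eqVneq k j) => [->|kj] /=; first by move: yj; case: (y j); case: (x j).
by move: h; rewrite in_std_face => /forallP /(_ k); rewrite !inE (negbTE ki) (negbTE kj).
Qed.

(** Flips connect the vertices: induction on the number of coordinates in which [x] and [y]
    differ. *)
Lemma std_flip_ind (T : Type) (F : std_vertex q -> T) :
  (forall i x, F (std_flip i x) = F x) -> forall x y, F x = F y.
Proof.
move=> hF x y; move En: #|[set i | x i != y i]| => n.
elim: n x En => [|n IH] x En.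
  congr F; apply/ffunP => i; apply/eqP; apply: contraT => xy.
  by have := card0_eq En i; rewrite inE xy.
have /card_gt0P[i] : 0 < #|[set i | x i != y i]| by rewrite En.
rewrite inE => xy; rewrite -(hF i x); apply: IH.
move: En; rewrite (cardsD1 i) inE xy => -[<-]; apply: eq_card => j.
rewrite !inE ffunE; case: (eqVneq j i) => [->|_] //=.
by move: xy; case: (x i); case: (y i).
Qed.

End StandardCube.

Section Cubes.
Variable X : cube_complex.
Implicit Types (C D e : {set X}) (u v a b c : X).

Section Chart.
Variables (C : {set X}) (q : nat) (f : {ffun std_vertex q -> X}).
Hypothesis hf : is_chart (cubes X) C f.

Lemma chart_inj : injective f.
Proof. by case/and3P: hf => /injectiveP. Qed.

Lemma chart_image : f @: [set: std_vertex q] = C.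
Proof. by case/and3P: hf => _ /eqP. Qed.

Lemma chart_in x : f x \in C.
Proof. by rewrite -chart_image imset_f. Qed.

Lemma chart_surj u : u \in C -> exists x, u = f x.
Proof. by rewrite -chart_image => /imsetP[x _ ->]; exists x. Qed.

Lemma chart_card : #|C| = 2 ^ q.
Proof.
by rewrite -chart_image card_imset ?cardsT ?card_ffun ?card_bool ?card_ord //; apply: chart_inj.
Qed.

Lemma chart_faces D : (D \in cubes X) && (D \subset C) =
  (D \in [set f @: (F : {set std_vertex q}) | F in std_faces q]).
Proof. by case/and3P: hf => _ _ /eqP <-; rewrite inE. Qed.

Lemma chart_face J x : f @: std_face J x \in cubes X.
Proof.
have : f @: std_face J x \in [set f @: (F : {set std_vertex q}) | F in std_faces q].
  by apply: imset_f; apply/imsetP; exists (J, x).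
by rewrite -chart_faces => /andP[].
Qed.

Lemma chart_sub D : D \in cubes X -> D \subset C -> exists J x, D = f @: std_face J x.
Proof.
move=> hD hDC; have := chart_faces D; rewrite hD hDC => /esym /imsetP[F /imsetP[[J x] _ ->] ->].
by exists J, x.
Qed.

End Chart.

Lemma cube_card C : C \in cubes X -> #|C| = 2 ^ dim C.
Proof. by case/cubes_chart => f /chart_card. Qed.

Lemma pair_edge u v : u != v -> ([set u; v] \in edges X) = ([set u; v] \in cubes X).
Proof. by move=> uv; rewrite inE /dim cards2 uv andbT. Qed.

Lemma adjacentE u v : adjacent u v = (u != v) && ([set u; v] \in cubes X).
Proof. by rewrite /adjacent /=; case: (eqVneq u v) => //= uv; rewrite pair_edge. Qed.

Lemma adjacent_sym : symmetric (@adjacent X).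
Proof. by move=> u v; rewrite !adjacentE eq_sym setUC. Qed.

Lemma adjacent_neq u v : adjacent u v -> u != v.
Proof. by rewrite adjacentE => /andP[]. Qed.

Lemma edgeP e : e \in edges X -> exists u v, adjacent u v /\ e = [set u; v].
Proof.
move=> he; have : #|e| = 2.
  by move: he; rewrite inE => /andP[/cube_card -> /eqP ->].
move/eqP/cards2P => [u [v [uv E]]]; exists u, v; split=> //.
by rewrite /adjacent /= uv -E he.
Qed.

Lemma edge_at e v : e \in edges X -> v \in e -> exists u, adjacent v u /\ e = [set v; u].
Proof.
case/edgeP => a [b [ab ->]]; rewrite !inE => /orP[]/eqP ->; first by exists b.
by exists a; rewrite adjacent_sym ab setUC.
Qed.

(** An edge inside a cube is one of its faces, so the graph of [X] restricts to that of the standard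
    cube. *)
Lemma chart_adj C q (f : {ffun std_vertex q -> X}) x y : is_chart (cubes X) C f ->
  reflect (exists i, y = std_flip i x) (adjacent (f x) (f y)).
Proof.
move=> hf; have fI := chart_inj hf; rewrite adjacentE; apply: (iffP andP); last first.
  case=> i ->; split; first by rewrite (inj_eq fI) std_flip_neq.
  by have := chart_face hf [set i] x; rewrite std_face1 imsetU1 imset_set1.
case=> fxy hxy; have sxyC : [set f x; f y] \subset C.
  by apply/subsetP => z; rewrite !inE => /orP[]/eqP ->; apply: chart_in.
have [J [z E]] := chart_sub hf hxy sxyC.
have mem w : (w \in std_face J z) = (w \in [set x; y]).
  by rewrite -(mem_imset _ _ fI) -E !inE !(inj_eq fI).
have /std_face_eq EF : x \in std_face J z by rewrite mem set21.
have : y \in std_face J z by rewrite mem set22.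
have xy : x != y by rewrite -(inj_eq fI).
(* A coordinate in which [x] and [y] differ is free in the face, which has no other vertices. *)
have [i yi] : exists i, y i != x i.
  apply/existsP; apply: contraNT xy; rewrite negb_exists => /forallP h.
  by apply/eqP/ffunP => i; have := h i; rewrite negbK => /eqP.
rewrite EF in_std_face => /forallP /(_ i); rewrite (negbTE yi) implybF negbK => iJ.
exists i; have : std_flip i x \in std_face J z by rewrite EF std_flip_face ?std_face_refl.
by rewrite mem !inE eq_sym (negbTE (std_flip_neq i x)) => /eqP.
Qed.

(** * Squares and links *)

Definition square a b c d : bool :=
  [&& a != c, b != d, adjacent a b, adjacent b c, adjacent c d, adjacent d a
    & [set a; b; c; d] \in cubes X].

Lemma square_rot a b c d : square a b c d -> square b c d a.
Proof.
case/and5P=> ac bd ab bc /and3P[cd da Q]; rewrite /square bd eq_sym ac bc cd da ab /=.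
suff -> : [set b; c; d; a] = [set a; b; c; d] by [].
by apply/setP => x; rewrite !inE; case: (x == a); case: (x == b); case: (x == c); case: (x == d).
Qed.

Lemma square_sym a b c d : square a b c d -> square a d c b.
Proof.
case/and5P=> ac bd ab bc /and3P[cd da Q]; rewrite /square ac eq_sym bd !(adjacent_sym a).
rewrite (adjacent_sym d c) (adjacent_sym c b) da cd bc (adjacent_sym b) ab /=.
suff -> : [set a; d; c; b] = [set a; b; c; d] by [].
by apply/setP => x; rewrite !inE; case: (x == a); case: (x == b); case: (x == c); case: (x == d).
Qed.

Lemma square_adj a b c d : square a b c d -> adjacent a b.
Proof. by case/and5P. Qed.

Lemma square_neq a b c d : square a b c d -> a != c.
Proof. by case/and5P. Qed.

Lemma square_cube a b c d : square a b c d -> [set a; b; c; d] \in cubes X.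
Proof. by case/and5P=> ? ? ? ? /and3P[]. Qed.

(** The intersection is a cube with 3 or 4 vertices, hence with 4, so the two squares coincide. *)
Lemma square_uniq a b c d d' : square a b c d -> square a b c d' -> d = d'.
Proof.
move=> s s'; have := cubesI (square_cube s) (square_cube s').
set I := _ :&: _ => hI.
have ab : a != b := adjacent_neq (square_adj s).
have bc : b != c := adjacent_neq (square_adj (square_rot s)).
have ac : a != c := square_neq s.
have sub3 : [set a; b; c] \subset I.
  by apply/subsetP => x; rewrite !inE => /orP[/orP[]|] ->; rewrite ?orbT.
have card3 : #|[set a; b; c]| = 3.
  by rewrite setUC cardsU1 cards2 ab !inE negb_or !(eq_sym c) ac bc.
have cardQ x : #|[set a; b; c; x]| <= 4 by rewrite setUC cardsU1 card3; case: (_ \notin _).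
have le3 : 3 <= #|I| by rewrite -card3 subset_leq_card.
have leI : #|I| <= 4 by apply: leq_trans (cardQ d); apply: subset_leq_card; apply: subsetIl.
have I0 : I != set0 by rewrite -card_gt0; apply: leq_trans le3.
have := cube_card (hI I0); case: (dim I) => [|[|[|n]]] E; rewrite E // in le3 leI; last first.
  by have := leq_trans (leq_pexp2l (isT : 0 < 2) (isT : 3 <= n.+3)) leI.
have EI x : I \subset [set a; b; c; x] -> I = [set a; b; c; x].
  by move=> sI; apply/eqP; rewrite eqEcard sI E cardQ.
have /setP/(_ d) := etrans (esym (EI d (subsetIl _ _))) (EI d' (subsetIr _ _)).
have bd := square_neq (square_rot s).
have cd := adjacent_neq (square_adj (square_rot (square_rot s))).
have da := adjacent_neq (square_adj (square_rot (square_rot (square_rot s)))).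
rewrite !inE eqxx orbT (negbTE da) (eq_sym d b) (negbTE bd) (eq_sym d c) (negbTE cd) /=.
by move/esym/eqP.
Qed.

Lemma chart_square C q (f : {ffun std_vertex q -> X}) x i j :
  is_chart (cubes X) C f -> i != j ->
  square (f x) (f (std_flip i x)) (f (std_flip j (std_flip i x))) (f (std_flip j x)).
Proof.
move=> hf ij; have fI := chart_inj hf.
have adj z k : adjacent (f z) (f (std_flip k z)) by apply/(chart_adj _ _ hf); exists k.
have ji : j != i by rewrite eq_sym.
rewrite /square !(inj_eq fI); apply/and5P; split => //.
- apply: contra ij => /eqP E; apply/eqP/(@std_flip_inj _ _ _ x).
  by rewrite {2}E std_flipK.
- by apply: contra ij => /eqP /std_flip_inj ->.
- apply/and3P; split; first by rewrite std_flipC adjacent_sym.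
    by rewrite adjacent_sym.
  by have := chart_face hf [set i; j] x; rewrite std_face2 // !imsetU !imset_set1.
Qed.

Lemma chart_nbr C q (f : {ffun std_vertex q -> X}) x u : is_chart (cubes X) C f ->
  u \in C -> adjacent (f x) u -> exists i, u = f (std_flip i x).
Proof.
move=> hf /(chart_surj hf)[y ->] /(chart_adj _ _ hf)[i ->].
by exists i.
Qed.

(** With a diagonal edge, [b], [c] and [d] would all be single flips of [a] in a chart, leaving no
    vertex for the double flip of [a] through [b] and [d]. *)
Lemma square_diag a b c d : square a b c d -> ~~ adjacent a c.
Proof.
move=> s; have hQ := square_cube s; have [f hf] := cubes_chart hQ; move: (dim _) f hf => q f hf.
have fI := chart_inj hf; apply/negP => ac.
have bd := square_neq (square_rot s).
have ab := square_adj s; have ad := square_adj (square_sym s).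
have in4 u : u \in [:: a; b; c; d] -> u \in [set a; b; c; d] by rewrite !inE !orbA.
have [x ax] := chart_surj hf (in4 a (mem_head _ _)).
have nbr u : adjacent a u -> u \in [:: a; b; c; d] -> exists i, u = f (std_flip i x).
  by move=> au /in4 uQ; apply: (chart_nbr hf uQ); rewrite -ax.
have [i bi] : exists i, b = f (std_flip i x) by apply: nbr; rewrite // !inE eqxx ?orbT.
have [k ck] : exists i, c = f (std_flip i x) by apply: nbr; rewrite // !inE eqxx ?orbT.
have [j dj] : exists i, d = f (std_flip i x) by apply: nbr; rewrite // !inE eqxx ?orbT.
have ij : i != j by apply: contraNneq bd => E; rewrite bi dj E.
have := chart_in hf (std_flip j (std_flip i x)).
rewrite !inE ax bi ck dj !(inj_eq fI) !(negbTE (std_flip2_neq _ x ij)) !orbF.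
move/eqP => E; case/eqP: ij; apply: (@std_flip_inj _ _ _ x).
by rewrite -{2}E std_flipK.
Qed.

(** The diagonal from [v] to [c] is not an edge, so the square contributes exactly these two edges
    at [v]. *)
Lemma link_square v a b c : square v a c b ->
  [set [set v; a]; [set v; b]] \in link v.
Proof.
move=> s; have va := square_adj s; have vb := square_adj (square_sym s).
apply/imsetP; exists [set v; a; c; b]; first by rewrite inE square_cube //= !inE eqxx.
have edge u : adjacent v u -> [set v; u] \in edges X.
  by move=> vu; rewrite pair_edge ?(adjacent_neq vu) //; move: vu; rewrite adjacentE => /andP[].
apply/setP => e; rewrite !inE; apply/idP/idP => [/orP[]/eqP ->|].
- have := edge a va; rewrite inE => ->; rewrite !inE eqxx /=.
  by apply/subsetP => x; rewrite !inE => /orP[] ->; rewrite ?orbT.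
- have := edge b vb; rewrite inE => ->; rewrite !inE eqxx /=.
  by apply/subsetP => x; rewrite !inE => /orP[] ->; rewrite ?orbT.
case/and3P=> he ve /subsetP se.
have [|u [vu Eu]] := @edge_at e v _ ve; first by rewrite inE.
have : u \in [set v; a; c; b] by apply: se; rewrite Eu set22.
rewrite !inE -!orbA => /or4P[]/eqP E; rewrite Eu E ?eqxx ?orbT //.
  by have := adjacent_neq vu; rewrite E eqxx.
by have := square_diag s; rewrite -E vu.
Qed.

Lemma link_edge v a : adjacent v a -> [set [set v; a]] \in link v.
Proof.
move=> va; have := va; rewrite adjacentE => /andP[nva hva].
apply/imsetP; exists [set v; a]; first by rewrite inE hva set21.
apply/setP => e; rewrite !inE; apply/eqP/idP => [->|/and3P[he ve]].
  by rewrite hva subxx set21 /dim cards2 nva.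
have [|u [vu ->]] := @edge_at e v _ ve; first by rewrite inE.
move/subsetP/(_ u); rewrite !inE eqxx orbT => /(_ isT) /orP[]/eqP E; last by rewrite E.
by have := adjacent_neq vu; rewrite E eqxx.
Qed.

(** The squares join the edges from [v] to [A] pairwise in the link, so these edges form a simplex;
    [C] is a cube that contributes it. *)
Lemma flag_cube v (A : {set X}) : flag (link v) ->
  (forall a, a \in A -> adjacent v a) ->
  (forall a b, a \in A -> b \in A -> a != b -> exists c, square v a c b) ->
  exists C, [/\ C \in cubes X, v \in C & forall a, adjacent v a -> (a \in C) = (a \in A)].
Proof.
move=> fl adjA sqA.
have pair_inj a b : adjacent v a -> adjacent v b -> [set v; a] = [set v; b] -> a = b.
  move=> va vb /setP/(_ a); rewrite !inE eqxx orbT => /esym/orP[]/eqP // E.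
  by have := adjacent_neq va; rewrite E eqxx.
have : [set [set v; a] | a in A] \in link v.
  apply: fl => _ _ /imsetP[a aA ->] /imsetP[b bA ->].
  (* [flag] also asks for pairs with equal members, which are the vertices of the link. *)
  case: (eqVneq a b) => [->|ab]; first by rewrite setUid link_edge ?adjA.
  by have [c s] := sqA a b aA bA ab; apply: link_square s.
case/imsetP=> C; rewrite inE => /andP[hC vC] E; exists C; split=> // a va.
have := va; rewrite adjacentE => /andP[nva hva].
have : ([set v; a] \in [set [set v; a] | a in A]) = ([set v; a] \subset C).
  by rewrite E inE pair_edge // hva set21.
rewrite subUset !sub1set vC /= => <-; apply/imsetP/idP => [[b bA /pair_inj]|aA].
  by move=> -> //; apply: adjA.
by exists a.
Qed.

(** * The metric of a CAT(0) complex *)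

Section CAT0.
Hypothesis hX : CAT0 X.

(** Flagness at [y] gives a cube in which [a], [b], [c] are the flips of [y] along [i], [j], [k];
    the corner [t] is the triple flip. *)
Lemma square_threecube y a b c p q r :
  square y a p b -> square y b q c -> square y a r c ->
  exists t, [/\ square a p t r, square b p t q & square c q t r].
Proof.
move=> sab sbc sac.
have ya := square_adj sab; have yb := square_adj sbc; have yc := square_adj (square_sym sac).
have [|||C [hC yC nC]] := @flag_cube y [set a; b; c].
- by case: hX.
- by move=> u; rewrite !inE -!orbA => /or3P[]/eqP ->.
- move=> u w; rewrite !inE -!orbA.
  move=> /or3P[]/eqP -> /or3P[]/eqP ->; rewrite ?eqxx // => _;
  by [exists p | exists q | exists r | exists p; apply: square_sym
     | exists q; apply: square_sym | exists r; apply: square_sym].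
have [f hf] := cubes_chart hC; have [x Ex] := chart_surj hf yC.
have nbr u : adjacent y u -> u \in [set a; b; c] -> exists i, u = f (std_flip i x).
  by move=> yu; rewrite -nC // => uC; apply: (chart_nbr hf uC); rewrite -Ex.
have [i Ei] : exists i, a = f (std_flip i x) by apply: nbr; rewrite // !inE eqxx.
have [j Ej] : exists i, b = f (std_flip i x) by apply: nbr; rewrite // !inE eqxx orbT.
have [k Ek] : exists i, c = f (std_flip i x) by apply: nbr; rewrite // !inE eqxx orbT.
(* By uniqueness of squares, the given squares are faces of this cube. *)
have mid u w m i' j' : square y u m w -> u = f (std_flip i' x) -> w = f (std_flip j' x) ->
    i' != j' /\ m = f (std_flip j' (std_flip i' x)).
  move=> s Eu Ew; have uw := square_neq (square_rot s).
  have ij' : i' != j' by apply: contraNneq uw => E; rewrite Eu Ew E.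
  split=> //; have s' := chart_square x hf ij'; rewrite -Ex -Eu -Ew in s'.
  by apply: square_uniq (square_rot (square_rot (square_rot s)))
              (square_rot (square_rot (square_rot s'))).
have [ij Ep] := mid _ _ _ _ _ sab Ei Ej.
have [jk Eq] := mid _ _ _ _ _ sbc Ej Ek.
have [ik Er] := mid _ _ _ _ _ sac Ei Ek.
exists (f (std_flip k (std_flip j (std_flip i x)))); split.
- by rewrite Ei Ep Er; apply: chart_square hf jk.
- by rewrite Ej Ep Eq (std_flipC j i); apply: chart_square hf ik.
rewrite Ek Eq Er (std_flipC j i x) (std_flipC k i) !(std_flipC k _ x).
by apply: chart_square hf _; rewrite eq_sym.
Qed.

Lemma homotopic_evals (p1 p2 : seq X) : homotopic p1 p2 ->
  swap square (evals square p1) (evals square p2).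
Proof.
have back := evals_backtrack square_rot square_sym square_neq square_uniq square_threecube.
elim=> [p|p q _ IH|p q r _ IH1 _ IH2|p s u v _|p s a b c d Q ab bc ad dc].
- exact: Swap_refl.
- by apply: swap_sym IH; apply: square_sym.
- exact: swap_trans IH1 IH2.
- exact: back.
(* The homotopy move also admits [a = c], where it amounts to two backtracks, and [b = d], where it
   changes nothing. *)
case: (eqVneq a c) => [<-|ac].
  apply: swap_trans (back p s a b) _; apply: swap_sym (back p s a d).
  exact: square_sym.
case: (eqVneq b d) => [->|bd]; first exact: Swap_refl.
apply: (evals_square square_rot square_sym square_neq square_uniq square_threecube).
by apply/and5P; split=> //; apply/and3P; split=> //; rewrite adjacent_sym.
Qed.

Lemma CAT0_metric : exists d : X -> X -> nat,
  [/\ forall u, d u u = 0, forall u v, d u v = d v u,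
      forall u v z, adjacent v z -> d u z = (d u v).+1 \/ d u v = (d u z).+1,
      forall u v, u != v -> exists2 a, adjacent v a & d u v = (d u a).+1 &
      forall u v a b, adjacent v a -> adjacent v b -> a != b ->
        d u v = (d u a).+1 -> d u v = (d u b).+1 ->
        exists2 c, square v a c b & d u a = (d u c).+1].
Proof.
case: hX => -[conn loop] _.
apply: (exists_metric adjacent_sym square_adj square_rot square_sym square_neq
          square_uniq square_threecube conn) => u p pp lp.
exact: (homotopic_evals (loop u p pp lp)).
Qed.

End CAT0.

(** * Hyperplanes and walls *)

Section Walls.
Variable d : X -> X -> nat.
Hypothesis dxx : forall u, d u u = 0.
Hypothesis d_sym : forall u v, d u v = d v u.
Hypothesis d_adj : forall u v z, adjacent v z -> d u z = (d u v).+1 \/ d u v = (d u z).+1.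
Hypothesis d_desc : forall u v, u != v -> exists2 a, adjacent v a & d u v = (d u a).+1.
Hypothesis d_quad : forall u v a b, adjacent v a -> adjacent v b -> a != b ->
  d u v = (d u a).+1 -> d u v = (d u b).+1 ->
  exists2 c, square v a c b & d u a = (d u c).+1.

(** The [wall] of an edge given as a vertex set, without choosing an orientation. *)
Definition edge_wall e : {set {set X}} :=
  [set halfspace d p.1 p.2 | p : X * X in [set p | [&& p.1 \in e, p.2 \in e & p.1 != p.2]]].

Definition walls C : {set {set {set X}}} := [set edge_wall e | e in edges X & e \subset C].

Lemma edge_wallE u v : u != v -> edge_wall [set u; v] = wall d u v.
Proof.
move=> uv; apply/setP => h; apply/imsetP/idP => [[[x y]]|].
  rewrite !inE /= => /and3P[/orP[]/eqP -> /orP[]/eqP ->]; rewrite ?eqxx // => _ ->;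
  by rewrite eqxx ?orbT.
rewrite !inE => /orP[]/eqP ->; [exists (u, v)|exists (v, u)] => //=.
  by rewrite !inE !eqxx orbT.
by rewrite !inE !eqxx orbT /= eq_sym.
Qed.

Lemma adjacent_edge u v : adjacent u v -> [set u; v] \in edges X.
Proof. by case/andP. Qed.

(** Flips in the other coordinates move an edge of direction [i] across squares, which preserve its
    wall; the flip in [i] only reverses it. *)
Lemma chart_edge_wall C q (f : {ffun std_vertex q -> X}) x y i : is_chart (cubes X) C f ->
  edge_wall [set f x; f (std_flip i x)] = edge_wall [set f y; f (std_flip i y)].
Proof.
move=> hf; move: x y.
apply: (std_flip_ind (F := fun x => edge_wall [set f x; f (std_flip i x)])) => j x.
have neq z : f z != f (std_flip i z) by rewrite (inj_eq (chart_inj hf)) std_flip_neq.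
case: (eqVneq i j) => [<-|ij]; first by rewrite std_flipK setUC.
rewrite !edge_wallE //
  [LHS](_ : _ = wall d (f (std_flip j x)) (f (std_flip j (std_flip i x)))).
  symmetry; apply: (wall_sq adjacent_sym square_adj square_rot square_sym square_neq
          square_uniq d_adj d_quad).
  exact: chart_square hf ij.
by rewrite std_flipC.
Qed.

Lemma edge_chart C q (f : {ffun std_vertex q -> X}) e : is_chart (cubes X) C f ->
  reflect (exists i x, e = [set f x; f (std_flip i x)]) ((e \in edges X) && (e \subset C)).
Proof.
move=> hf; apply: (iffP andP) => [[/edgeP[u [v [uv ->]]]]|[i [x ->]]].
  rewrite subUset !sub1set => /andP[/(chart_surj hf)[x Ex] vC].
  by rewrite Ex in uv *; case: (chart_nbr hf vC uv) => i ->; exists i, x.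
have adj : adjacent (f x) (f (std_flip i x)) by apply/(chart_adj _ _ hf); exists i.
by split; [exact: adjacent_edge | rewrite subUset !sub1set !(chart_in hf)].
Qed.

Lemma chart_walls C q (f : {ffun std_vertex q -> X}) x : is_chart (cubes X) C f ->
  walls C = [set edge_wall [set f x; f (std_flip i x)] | i : 'I_q].
Proof.
move=> hf; apply/setP => w; apply/imsetP/imsetP => [[e]|[i _ ->]].
  rewrite inE => /(edge_chart _ hf)[i [y ->]] ->; exists i => //.
  exact: chart_edge_wall hf.
exists [set f x; f (std_flip i x)] => //.
by rewrite inE; apply/(edge_chart _ hf); exists i, x.
Qed.

(** The edges at a single vertex represent all walls of the cube, and [wall_inj] keeps them
    distinct. *)
Lemma card_walls C : C \in cubes X -> #|walls C| = dim C.
Proof.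
case/cubes_chart => f hf; pose x : std_vertex (dim C) := [ffun=> false].
have adj i : adjacent (f x) (f (std_flip i x)) by apply/(chart_adj _ _ hf); exists i.
rewrite (chart_walls x hf) card_imset ?card_ord // => i j.
rewrite !edge_wallE ?(adjacent_neq (adj _)) //.
move/(wall_inj dxx d_sym d_adj d_desc (adj i) (adj j)) /(chart_inj hf).
exact: std_flip_inj.
Qed.

Lemma walls_at C v : C \in cubes X -> v \in C ->
  walls C = [set wall d v a | a in C & adjacent v a].
Proof.
move=> /cubes_chart[f hf] /(chart_surj hf)[x ->]; rewrite (chart_walls x hf).
have adj i : adjacent (f x) (f (std_flip i x)) by apply/(chart_adj _ _ hf); exists i.
apply/setP => w; apply/imsetP/imsetP => [[i _ ->]|[a]].
  exists (f (std_flip i x)); first by rewrite inE (chart_in hf) adj.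
  by rewrite edge_wallE ?adjacent_neq.
rewrite inE => /andP[aC xa] ->; have [i Ei] := chart_nbr hf aC xa.
by exists i; rewrite // -Ei edge_wallE ?adjacent_neq.
Qed.

Lemma midplanes_ofP C M : reflect
  (exists (f : {ffun std_vertex (dim C) -> X}) i, is_chart (cubes X) C f /\ M = chart_midplane f i)
  (M \in midplanes_of C).
Proof.
rewrite inE; apply: (iffP existsP) => [[f /andP[hf /existsP[i /eqP E]]]|[f [i [hf E]]]].
  by exists f, i.
by exists f; rewrite hf; apply/existsP; exists i; rewrite E.
Qed.

Lemma midplane_edge M e : M \in midplanes X -> e \in M -> e \in edges X.
Proof.
case/bigcupP => C _ /midplanes_ofP[f [i [hf ->]]] /imsetP[x _ ->].
by apply: adjacent_edge; apply/(chart_adj _ _ hf); exists i.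
Qed.

Lemma midplane_wall M e e' : M \in midplanes X -> e \in M -> e' \in M ->
  edge_wall e = edge_wall e'.
Proof.
case/bigcupP => C _ /midplanes_ofP[f [i [hf ->]]] /imsetP[x _ ->] /imsetP[y _ ->].
exact: chart_edge_wall hf.
Qed.

Lemma midplane_neq0 M : M \in midplanes X -> exists e, e \in M.
Proof.
case/bigcupP => C _ /midplanes_ofP[f [i [hf ->]]].
by exists [set f [ffun=> false]; f (std_flip i [ffun=> false])]; apply: imset_f.
Qed.

(** The midpoint of an edge, represented by the edge, is its midplane as a 1-cube. *)
Lemma midplane1 e : e \in edges X -> [set e] \in midplanes X.
Proof.
move=> he; have hC : e \in cubes X by move: he; rewrite inE => /andP[].
have [f hf] := cubes_chart hC.
have dim_gt0 : 0 < dim e by move: he; rewrite inE => /andP[_ /eqP ->].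
apply/bigcupP; exists e => //; apply/midplanes_ofP; exists f, (Ordinal dim_gt0); split=> //.
set i := Ordinal _; have E x : [set f x; f (std_flip i x)] = e.
  apply/eqP; rewrite eqEcard cards2 (inj_eq (chart_inj hf)) std_flip_neq.
  rewrite subUset !sub1set !(chart_in hf) (cube_card hC).
  by move: he; rewrite inE => /andP[_ /eqP ->].
apply/setP => z; rewrite inE; apply/eqP/imsetP => [->|[x _ ->]] //.
by exists [ffun=> false].
Qed.

Lemma midplane_step_sym : symmetric (@midplane_step X).
Proof. by move=> M N; rewrite /midplane_step /= andbCA setIC. Qed.

Lemma midplane_equiv_sym : symmetric (@midplane_equiv X).
Proof. exact: sym_connect_sym midplane_step_sym. Qed.

Lemma midplane_equiv1 M e : M \in midplanes X -> e \in M -> midplane_equiv [set e] M.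
Proof.
move=> hM eM; apply: connect1; rewrite /midplane_step /= midplane1 ?(midplane_edge hM) //= hM /=.
have /setIidPl -> : [set e] \subset M by rewrite sub1set.
by rewrite midplane1 ?(midplane_edge hM).
Qed.

(** Consecutive midplanes share an edge, and all edges of one midplane have the same wall. *)
Lemma midplane_equiv_wall M N e e' : M \in midplanes X -> midplane_equiv M N ->
  e \in M -> e' \in N -> edge_wall e = edge_wall e'.
Proof.
move=> hM /connectP[p pp ->]; elim: p M e hM pp => /= [|N' p IH] M e hM.
  by move=> _; apply: midplane_wall.
case/andP=> /and3P[_ hN' /midplane_neq0[z]]; rewrite inE => /andP[zM zN'] pp eM e'N.
by rewrite (midplane_wall hM eM zM); apply: IH hN' pp zN' e'N.
Qed.

Lemma square_midplane a b b' a' : square a b b' a' ->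
  exists M, [/\ M \in midplanes X, [set a; b] \in M & [set a'; b'] \in M].
Proof.
move=> s; have := square_cube s.
have : [&& a \in [set a; b; b'; a'], b \in [set a; b; b'; a'] & a' \in [set a; b; b'; a']].
  by rewrite !inE !eqxx !orbT.
move: [set a; b; b'; a'] => C /and3P[aC bC a'C] hC; have [f hf] := cubes_chart hC.
have [x Ex] := chart_surj hf aC.
have [i Ei] : exists i, b = f (std_flip i x).
  by apply: (chart_nbr hf bC); rewrite -Ex; apply: square_adj s.
have [j Ej] : exists j, a' = f (std_flip j x).
  by apply: (chart_nbr hf a'C); rewrite -Ex; apply: square_adj (square_sym s).
have ij : i != j.
  by apply: contraNneq (square_neq (square_rot s)) => E; rewrite Ei Ej E.
have s' := chart_square x hf ij; rewrite -Ex -Ei -Ej in s'.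
have Eb' : b' = f (std_flip i (std_flip j x)).
  rewrite std_flipC; apply: square_uniq (square_rot (square_rot (square_rot _))) _.
    exact: square_sym s.
  exact: square_rot (square_rot (square_rot (square_sym s'))).
exists (chart_midplane f i); split.
- by apply/bigcupP; exists C => //; apply/midplanes_ofP; exists f, i.
- by apply/imsetP; exists x => //; rewrite -Ex -Ei.
by apply/imsetP; exists (std_flip j x) => //; rewrite -Ej -Eb'.
Qed.

(** Each square of the ladder joining the edges has a midplane that contains both of its rungs. *)
Lemma edge_wall_equiv e e' : e \in edges X -> e' \in edges X -> edge_wall e = edge_wall e' ->
  midplane_equiv [set e] [set e'].
Proof.
move=> /edgeP[u [v [uv ->]]] /edgeP[u' [v' [uv' ->]]].
rewrite !edge_wallE ?adjacent_neq // => E.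
pose Q a b := midplane_equiv [set [set u; v]] [set [set a; b]].
suff : Q u' v' by [].
apply: (wall_ladder (Q := fun a b => Q a b) adjacent_sym square_adj square_rot square_sym square_neq
          square_uniq dxx d_sym d_adj d_desc d_quad _ _ uv uv' E).
- by move=> a b; rewrite /Q (setUC [set b]).
- move=> a b b' a' s h; apply: connect_trans h _.
  have [M [hM aM a'M]] := square_midplane s.
  apply: connect_trans (midplane_equiv1 hM aM) _.
  by rewrite -/(midplane_equiv _ _) midplane_equiv_sym; apply: midplane_equiv1.
exact: connect0.
Qed.

(** Hyperplanes are thus the fibres of [edge_wall], which turns [cuts] into membership in
    [walls]. *)
Lemma in_hyperplane M e0 e : M \in midplanes X -> e0 \in M ->
  (e \in \bigcup_(N in midplanes X | midplane_equiv M N) N) =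
  (e \in edges X) && (edge_wall e == edge_wall e0).
Proof.
move=> hM e0M; apply/bigcupP/andP => [[N /andP[hN MN] eN]|[he /eqP E]].
  by rewrite (midplane_edge hN eN) (midplane_equiv_wall hM MN e0M eN).
exists [set e]; last by rewrite inE.
rewrite midplane1 //=; apply: connect_trans (_ : midplane_equiv M [set e0]) _.
  by rewrite midplane_equiv_sym midplane_equiv1.
by apply: edge_wall_equiv; rewrite ?(midplane_edge hM e0M).
Qed.

Lemma cuts_walls C M e0 : C \in cubes X -> M \in midplanes X -> e0 \in M ->
  cuts (\bigcup_(N in midplanes X | midplane_equiv M N) N) C = (edge_wall e0 \in walls C).
Proof.
move=> hC hM e0M; apply/existsP/imsetP => [[N /andP[hN sN]]|[e]].
  have hN' : N \in midplanes X by apply/bigcupP; exists C.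
  case/midplanes_ofP: (hN) => f [i [hf EN]].
  have [e eN] := midplane_neq0 hN'; have := subsetP sN e eN.
  rewrite (in_hyperplane _ hM e0M) => /andP[he /eqP <-]; exists e => //.
  rewrite inE; apply/(edge_chart _ hf); move: eN; rewrite EN => /imsetP[x _ ->].
  by exists i, x.
have [f hf] := cubes_chart hC; rewrite inE => /(edge_chart _ hf)[i [x ->]] E.
exists (chart_midplane f i); apply/andP; split; first by apply/midplanes_ofP; exists f, i.
apply/subsetP => _ /imsetP[y _ ->]; rewrite (in_hyperplane _ hM e0M) E.
rewrite (chart_edge_wall y x _ hf) eqxx andbT.
by apply: adjacent_edge; apply/(chart_adj _ _ hf); exists i.
Qed.

(** The one-sided condition in [parallel] yields only an inclusion of walls; equal dimensions make
    it an equality, by [card_walls]. *)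
Lemma parallelE C D : C \in cubes X -> D \in cubes X -> parallel C D = (walls C == walls D).
Proof.
move=> hC hD; apply/andP/eqP => [[/eqP Ed /forallP h]|E]; last first.
  rewrite -(card_walls hC) -(card_walls hD) E; split=> //.
  apply/forallP => H; apply/implyP => /imsetP[M hM ->].
  by have [e0 e0M] := midplane_neq0 hM; rewrite !(cuts_walls _ hM e0M) // E implybb.
apply/eqP; rewrite eqEcard !card_walls // Ed leqnn andbT.
apply/subsetP => w wC; case/imsetP: (wC) => e; rewrite inE => /andP[he _] Ew.
have hM := midplane1 he; have eM : e \in [set e] by rewrite inE.
have := h (\bigcup_(N in midplanes X | midplane_equiv [set e] N) N).
rewrite imset_f //= !(cuts_walls _ hM eM) // -Ew wC; exact.
Qed.

Lemma card_parallelism_classes : #|parallelism_classes X| = #|walls @: cubes X|.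
Proof.
(* [cls] is injective on the sets of walls realised by cubes, and its values there are the
   parallelism classes. *)
pose cls w := [set D in cubes X | w == walls D].
rewrite -(@card_in_imset _ _ cls) => [|w1 w2 /imsetP[C hC ->] _ /setP/(_ C)]; last first.
  by rewrite !inE hC eqxx /= => /esym /eqP.
rewrite -imset_comp; congr #|pred_of_set _|; apply: eq_in_imset => C hC /=.
by apply/setP => D; rewrite !inE; case hD: (D \in _) => //=; apply: parallelE.
Qed.

(** * The cube below a vertex *)

Section Count.
Hypothesis hflag : forall v, flag (link v).
Variable o : X.

Definition down v : {set X} := [set a | adjacent v a & d o v == (d o a).+1].

(** The cube [C(v)]: the quadrangle condition supplies the squares for [flag_cube]. *)
Lemma down_cube v : exists C, [/\ C \in cubes X, v \in C
  & forall a, adjacent v a -> (a \in C) = (a \in down v)].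
Proof.
apply: flag_cube => // [a|a b]; first by rewrite inE => /andP[].
rewrite !inE => /andP[va /eqP da] /andP[vb /eqP db] ab.
by have [c s _] := d_quad va vb ab da db; exists c.
Qed.

Lemma walls_down C v : C \in cubes X -> v \in C ->
  (forall a, adjacent v a -> (a \in C) = (a \in down v)) ->
  walls C = [set wall d v a | a in down v].
Proof.
move=> hC vC h; rewrite (walls_at hC vC).
suff -> : [set a in C | adjacent v a] = down v by [].
apply/setP => a; rewrite inE; case va: (adjacent v a); first by rewrite andbT h.
by rewrite andbF inE va.
Qed.

Lemma down_walls_inj v w :
  [set wall d v a | a in down v] = [set wall d w a | a in down w] -> v = w.
Proof.
(* If the walls below [x] are among those below [y], then [x] lies on a geodesic from [o] to [y];
   otherwise [common_descent] yields a wall below [x] that is not below [y]. *)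
have le x y : [set wall d x a | a in down x] \subset [set wall d y a | a in down y] ->
    d o x + d x y <= d o y.
  move=> /subsetP sub; rewrite leqNgt; apply/negP => /(common_descent adjacent_sym
    square_adj square_rot dxx d_sym d_adj d_desc d_quad)[a [xa ex eyx]].
  have /imsetP[b] : wall d x a \in [set wall d y a | a in down y].
    by apply: sub; apply: imset_f; rewrite inE xa ex eqxx.
  rewrite inE => /andP[yb /eqP ey]; exact: wall_down_neq ey eyx.
move=> E; have := le v w; have := le w v; rewrite E subxx (d_sym w) => /(_ isT) h1 /(_ isT) h2.
by apply: (d_eq0 d_desc); lia.
Qed.

(* Among the cubes with the walls of [C] and their top vertices [v], take one with
   [d o v] minimal: a further wall below [v] would allow to push the cube across
   it, towards [o]. *)
Lemma walls_down_surj C : C \in cubes X ->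
  exists v, walls C = [set wall d v a | a in down v].
Proof.
move=> hC.
pose P n := [exists D : {set X}, exists v : X,
  [&& D \in cubes X, walls D == walls C, v \in D, d o v == n
    & [forall a in D, adjacent v a ==> (a \in down v)]]].
have exP : exists n, P n.
  have [v0 v0C] : exists v, v \in C.
    by apply/set0Pn; rewrite -card_gt0 cube_card // expn_gt0.
  (* A vertex of [C] farthest from [o] is a top vertex. *)
  case: (@arg_maxnP _ v0 (mem C) (d o) v0C) => v; rewrite -[mem C v]/(v \in C) => vC vmax.
  exists (d o v); apply/existsP; exists C; apply/existsP; exists v.
  rewrite hC vC !eqxx /=; apply/forallP => a; apply/implyP => aC; apply/implyP => va.
  rewrite inE va; apply/eqP; have /= le_a : d o a <= d o v := vmax a aC.
  by case: (d_adj o va) => //; lia.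
case: (ex_minnP exP) => n /existsP[D /existsP[v]].
case/and5P=> hD /eqP EC vD /eqP <- /forallP h min_n; exists v; rewrite -EC.
have {}h a : a \in D -> adjacent v a -> a \in down v by move=> aD va; have := h a; rewrite aD va.
apply/eqP; rewrite (walls_at hD vD) eqEsubset; apply/andP; split.
  by apply/subsetP => w /imsetP[a]; rewrite inE => /andP[aD va] ->; apply/imset_f/h.
apply/subsetP => _ /imsetP[a ad ->]; rewrite -walls_at //; apply: contraT => aW.
have va : adjacent v a by move: ad; rewrite inE => /andP[].
(* The cube [K] contains the edges of [D] at [v] and the edge to [a]; in its chart, [J] collects the
   directions of [D] and [i] is that of [a]. *)
have [K [hK vK nK]] := down_cube v; have [f hf] := cubes_chart hK.
have [x Ex] := chart_surj hf vK.
have [i Ei] : exists i, a = f (std_flip i x).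
  by apply: (chart_nbr hf); rewrite ?nK // -Ex.
pose J := [set j | f (std_flip j x) \in D].
have adj y j : adjacent (f y) (f (std_flip j y)) by apply/(chart_adj _ _ hf); exists j.
have iJ : i \notin J.
  apply: contra aW; rewrite inE -Ei => aD; rewrite (walls_at hD vD).
  by apply: imset_f; rewrite inE aD.
have JP b : b \in D -> adjacent v b -> exists2 j, j \in J & b = f (std_flip j x).
  move=> bD vb; have bK : b \in K by rewrite nK // h.
  have [|j Ej] := @chart_nbr _ _ f x b hf bK; first by rewrite -Ex.
  by exists j => //; rewrite inE -Ej.
(* The translate of [D] along the edge from [v] to [a]. *)
pose D' := f @: std_face J (std_flip i x).
have hD' : D' \in cubes X := chart_face hf _ _.
have aD' : a \in D' by rewrite Ei imset_f // std_face_refl.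
have nD' u : u \in D' -> adjacent a u ->
    exists2 j, j \in J & u = f (std_flip j (std_flip i x)).
  case/imsetP=> z zJ ->; rewrite Ei => /(chart_adj _ _ hf)[j Ez].
  by exists j; rewrite -?Ez //; move: zJ; rewrite Ez std_flip_face ?std_face_refl.
have wJ j : wall d a (f (std_flip j (std_flip i x))) = wall d v (f (std_flip j x)).
  by rewrite Ei Ex -!edge_wallE ?adjacent_neq ?adj // (chart_edge_wall _ x _ hf).
have EW : walls D' = walls D.
  rewrite (walls_at hD' aD') (walls_at hD vD).
  apply/setP => w; apply/imsetP/imsetP => [[u]|[b]]; rewrite inE => /andP[].
    move=> uD' au ->; have [j jJ ->] := nD' u uD' au.
    exists (f (std_flip j x)); last exact: wJ.
    by rewrite inE Ex adj andbT; move: jJ; rewrite inE.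
  move=> bD vb ->; have [j jJ ->] := JP b bD vb.
  exists (f (std_flip j (std_flip i x))); last by rewrite wJ.
  by rewrite inE Ei adj andbT imset_f // std_flip_face ?std_face_refl.
(* As [a] is closer to [o] than [v], it contradicts minimality once it is shown to be the top vertex
   of [D']. *)
suff /min_n : P (d o a) by move: ad; rewrite inE => /andP[_ /eqP ->]; rewrite ltnn.
apply/existsP; exists D'; apply/existsP; exists a; rewrite hD' aD' EW EC !eqxx /=.
apply/forallP => u; apply/implyP => uD'; apply/implyP => au; rewrite inE au /=.
have [j jJ Eu] := nD' u uD' au.
have bD : f (std_flip j x) \in D by move: jJ; rewrite inE.
have vb : adjacent v (f (std_flip j x)) by rewrite Ex.
have /andP[_ /eqP eb] :
    adjacent v (f (std_flip j x)) && (d o v == (d o (f (std_flip j x))).+1).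
  by have := h _ bD vb; rewrite inE.
have ij : i != j by apply: contraNneq iJ => ->.
have s := chart_square x hf ij; rewrite -Ex -Ei -Eu in s.
have [_ /eqP ea] : adjacent v a /\ d o v == (d o a).+1 by apply/andP; move: ad; rewrite inE.
(* [a] and the neighbour of [v] in direction [j] both descend from [v]; their quadrangle square is
   the chart square, so [u] is below [a]. *)
have [c s' ->] := d_quad va vb (square_neq (square_rot s)) ea eb.
rewrite eqSS (_ : c = u) //.
exact: square_uniq (square_rot (square_rot (square_rot s')))
         (square_rot (square_rot (square_rot s))).
Qed.

Lemma card_walls_image : #|walls @: cubes X| = #|vertex X|.
Proof.
rewrite -cardsT -(card_imset _ down_walls_inj); apply: eq_card => w.
apply/imsetP/imsetP => [[C /walls_down_surj[v ->] ->]|[v _ ->]]; first by exists v.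
have [C [hC vC nC]] := down_cube v; exists C => //.
exact: esym (walls_down hC vC nC).
Qed.

End Count.
End Walls.

End Cubes.

Theorem proposition4p5 (X : cube_complex) (hX : CAT0 X) :
  #|vertex X| = #|parallelism_classes X|.
Proof.
have [d [dxx d_sym d_adj d_desc d_quad]] := CAT0_metric hX.
rewrite (card_parallelism_classes dxx d_sym d_adj d_desc d_quad).
case: (pickP X) => [o _|X0].
  by rewrite (card_walls_image dxx d_sym d_adj d_desc d_quad (proj2 hX) o).
(* Without vertices there is no base point, but no cube either, since a cube has [2 ^ dim C]
   vertices. *)
rewrite (eq_card0 X0); symmetry; apply/eqP; rewrite cards_eq0 imset_eq0.
apply/eqP/setP => C; rewrite in_set0; apply/negP => /cube_card.
have -> : C = set0 by apply/setP => x; have := X0 x.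
by rewrite cards0 => /esym/eqP; rewrite expn_eq0.
Qed.
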